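(* Let $\mathfrak C\preceq{}^*\mathfrak A$ be small and let $\mu,\nu$ be probability measures over ${}^*\mathfrak A$ which are both countably definable over $\mathfrak C$. Then the map \[\xi:\varphi^{{}^*A}\longmapsto\int\mu\big(\{x\in{}^*A:{}^*\mathfrak A\models\varphi(x+y)\}\big)\,d\nu(y),\qquad \varphi(x)\text{ an }\mathcal L_{{}^*A}\text{-formula},\] is well defined and extends uniquely to a probability measure over ${}^*\mathfrak A$, and this probability measure is countably definable over $\mathfrak C$.
   Context: Let $\mathcal L$ be a first-order language and $\mathfrak A=(A,\dots)$ an $\mathcal L$-structure; assume either $\mathcal L$ is countable or $\mathrm{Th}(\mathfrak A)$ does not have the independence property. Fix an $\mathcal L$-formula $\theta(x,y,z)$ such that $\mathfrak A$ satisfies $\forall x y\exists! z\,\theta(x,y,z)$, $\forall xyz(\theta(x,y,z)\leftrightarrow\theta(y,x,z))$, associativity $\forall xyzw\big(\exists v(\theta(x,y,v)\wedge\theta(v,z,w))\leftrightarrow\exists u(\theta(y,z,u)\wedge\theta(x,u,w))\big)$ and $\exists x\forall y\,\theta(x,y,y)$; write $x+y=z$ for $\theta(x,y,z)$ and $0$ for the neutral element. Let $\kappa>|\mathcal L|+|A|$ be an uncountable inaccessible cardinal; work in a $\kappa$-saturated nonstandard universe containing a saturated elementary extension ${}^*\mathfrak A=({}^*A,\dots)$ of $\mathfrak A$ of cardinality $\kappa$; small means of cardinality $<\kappa$. For a small $\mathfrak C\preceq{}^*\mathfrak A$ and $\mathcal L_C$-formula $\varphi(\bar x)$ with $n$ free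 variables, $\varphi^{{}^*A}=\{\bar a\in{}^*A^n:{}^*\mathfrak A\models\varphi(\bar a)\}$; $\mathcal B^n_{\mathfrak C}$ is the algebra generated by these sets and $\sigma\mathcal B^n_{\mathfrak C}$ the generated $\sigma$-algebra. Let $\mathcal A$ be the $\sigma$-algebra on ${}^*A$ generated by small unions of sets $\varphi^{{}^*A}$, $\varphi(x)$ an $\mathcal L_{{}^*A}$-formula. A probability measure over ${}^*\mathfrak A$ is a $\sigma$-additive probability on $\mathcal A$ such that for every small set $S$ of sets $\varphi^{{}^*A}$ there is a countable $S_0\subseteq S$ with $\bigcup S,\bigcup S_0$ of equal measure. It is countably definable over $\mathfrak C$ if for each $n$ there is a countably generated subalgebra $\mathcal C_n\subseteq\sigma\mathcal B^n_{\mathfrak C}$ such that for every $\mathcal L$-formula $\varphi(x,\bar y)$, $\bar y$ of length $n$, the map $\bar y\mapsto\mu(\{x:{}^*\mathfrak A\models\varphi(x,\bar y)\})$ is $\mathcal C_n$-measurable. *)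

(* Defs.v *)
From HB Require Import structures.
From mathcomp Require Import all_boot all_order all_algebra.
From mathcomp Require Import all_classical all_reals all_analysis.
From mathcomp Require Import measurable_realfun.

Set Implicit Arguments.
Unset Strict Implicit.
Unset Printing Implicit Defensive.

Local Open Scope classical_set_scope.

(** * First-order logic *)

(* Constants are the function symbols of arity 0. *)
Record language := Language {
  fsym : Type;
  far : fsym -> nat;
  rsym : Type;
  rar : rsym -> nat
}.

Definition symbols (L : language) : Type := (fsym L + rsym L)%type.

(* The carrier is a [pointedType] because structures are nonempty and because
   [measurableType]s are pointed. *)
Record structure (L : language) := Structure {
  carrier :> pointedType;
  fint : forall f : fsym L, ('I_(far f) -> carrier) -> carrier;
  rint : forall r : rsym L, ('I_(rar r) -> carrier) -> Prop
}.

Inductive term (L : language) (n : nat) : Type :=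
| Var : 'I_n -> term L n
| App : forall f : fsym L, ('I_(far f) -> term L n) -> term L n.

(* [formula L n]: formulas whose free variables are among n given ones (well
   scoped de Bruijn syntax).  [FEx] binds the variable [ord0]; the remaining
   variables are shifted by [lift ord0]. *)
Inductive formula (L : language) : nat -> Type :=
| FEq : forall n, term L n -> term L n -> formula L n
| FRel : forall n (r : rsym L), ('I_(rar r) -> term L n) -> formula L n
| FNot : forall n, formula L n -> formula L n
| FAnd : forall n, formula L n -> formula L n -> formula L n
| FEx : forall n, formula L n.+1 -> formula L n.

Definition vcons (T : Type) (n : nat) (a : T) (v : 'I_n -> T) : 'I_n.+1 -> T :=
  fun k => if unlift ord0 k is Some k' then v k' else a.

Definition vcat (T : Type) (p q : nat) (a : 'I_p -> T) (b : 'I_q -> T) :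
    'I_(p + q) -> T :=
  fun k => match fintype.split k with inl i => a i | inr j => b j end.

Fixpoint eval (L : language) (M : structure L) (n : nat) (v : 'I_n -> M)
    (t : term L n) : M :=
  match t with
  | Var i => v i
  | App f ts => @fint L M f (fun k => eval v (ts k))
  end.

Fixpoint sat (L : language) (M : structure L) (n : nat) (phi : formula L n) :
    ('I_n -> M) -> Prop :=
  match phi in formula _ n return ('I_n -> M) -> Prop with
  | FEq _ s t => fun v => eval v s = eval v t
  | FRel _ r ts => fun v => @rint L M r (fun k => eval v (ts k))
  | FNot _ f => fun v => ~ sat f v
  | FAnd _ f g => fun v => sat f v /\ sat g v
  | FEx _ f => fun v => exists a : M, sat f (vcons a v)
  end.

Arguments sat {L} M {n} phi v.

Definition elementary_embedding (L : language) (M N : structure L)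
    (j : M -> N) : Prop :=
  forall (n : nat) (phi : formula L n) (v : 'I_n -> M),
    sat M phi v <-> sat N phi (j \o v).

(* The language L together with a new constant symbol for each c : C, and the
   expansion of M in which c is interpreted by [i c].  For [i] the inclusion of
   a set C of elements of M, the L_C-formulas are those of this language. *)
Definition add_constants (L : language) (C : Type) : language :=
  @Language (fsym L + C)%type
    (fun s => match s with inl f => far f | inr _ => 0%N end)
    (rsym L) (@rar L).

Definition expansion (L : language) (M : structure L) (C : Type) (i : C -> M) :
    structure (add_constants L C) :=
  @Structure (add_constants L C) (carrier M)
    (fun s : fsym (add_constants L C) =>
       match s return ('I_(@far (add_constants L C) s) -> M) -> M with
       | inl f => @fint L M f
       | inr c => fun=> i c
       end)
    (@rint L M).

Definition theory (L : language) (M : structure L) : set (formula L 0) :=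
  [set s | sat M s (fun=> point)].

(* Some formula phi(xs, ys) has, in some model of T, tuples a_k (k : nat) and
   b_S (S a set of natural numbers) such that phi(a_k, b_S) holds iff k is
   in S. *)
Definition has_independence_property (L : language) (T : set (formula L 0)) :
    Prop :=
  exists (p q : nat) (phi : formula L (p + q)) (M : structure L),
    T `<=` theory M /\
    exists (a : nat -> 'I_p -> M) (b : set nat -> 'I_q -> M),
      forall (k : nat) (S : set nat), sat M phi (vcat (a k) (b S)) <-> S k.

(** * Cardinals *)

Definition card_lt (T U : Type) (A : set T) (B : set U) : Prop :=
  (A #<= B)%card /\ ~ (B #<= A)%card.

(* A cardinal kappa is represented by a type K of that cardinality. *)
Definition small (K T : Type) (X : set T) : Prop := card_lt X [set: K].

Definition uncountable_inaccessible (K : Type) : Prop :=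
  [/\ ~ countable [set: K],
      (forall (I : set K) (F : K -> set K), small K I ->
         (forall k, I k -> small K (F k)) -> small K (\bigcup_(k in I) F k)) &
      (forall I : set K, small K I -> small K [set X : set K | X `<=` I])].

Definition saturated (L : language) (M : structure L) : Prop :=
  forall C : set M, card_lt C [set: M] ->
  forall p : set (formula (add_constants L (set_type C)) 1),
    (forall q, q `<=` p -> finite_set q ->
       exists a : M, forall phi, q phi ->
         sat (expansion (M := M) (@set_val M C)) phi (fun=> a)) ->
    exists a : M, forall phi, p phi ->
      sat (expansion (M := M) (@set_val M C)) phi (fun=> a).

(** * Definable sets and probability measures *)

Section Definable.
Variables (L : language) (M : structure L).

(* [solset phi]: the set defined by an L_M-formula in one variable. *)
Definition solset (phi : formula (add_constants L M) 1) : set M :=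
  [set a | sat (expansion (M := M) id) phi (fun=> a)].

(* The n-ary sets definable with parameters in the image of [i]; they already
   form an algebra of sets. *)
Definition definable (C : Type) (i : C -> M) (n : nat) :
    set (set ('I_n -> M)) :=
  [set [set v | sat (expansion i) phi v] |
    phi in [set: formula (add_constants L C) n]].

Arguments definable {C} i n _.

Definition sigma_definable (C : Type) (i : C -> M) (n : nat) :
    set (set ('I_n -> M)) := <<s definable i n >>.

Arguments sigma_definable {C} i n _.

Definition small_unions (K : Type) : set (set M) :=
  [set \bigcup_(X in S) X |
    S in [set S : set (set M) | small K S /\ S `<=` range solset]].

End Definable.

Arguments definable {L M C} i n _.
Arguments sigma_definable {L M C} i n _.

Notation definable_space K M := (g_sigma_algebraType (@small_unions _ M K)).

Section Measures.
Variables (R : realType) (L : language) (K : Type) (M : structure L).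

Definition probability_over (mu : probability (definable_space K M) R) : Prop :=
  forall S : set (set M), small K S -> S `<=` range (@solset L M) ->
    exists S0 : set (set M),
      [/\ S0 `<=` S, countable S0 &
          mu (\bigcup_(X in S) X) = mu (\bigcup_(X in S0) X)].

(* The countably generated sub-sigma-algebra is the one generated by G; it does
   not depend on phi.  The variable x of phi(x, ys) is the one of index 0. *)
Definition countably_definable (C : Type) (i : C -> M)
    (mu : probability (definable_space K M) R) : Prop :=
  forall n : nat, exists G : set (set ('I_n -> M)),
    [/\ countable G, G `<=` sigma_definable i n &
        forall phi : formula L n.+1,
          measurable_fun [set: g_sigma_algebraType G]
            ((fun ys => mu [set x : M | sat M phi (vcons x ys)])
              : g_sigma_algebraType G -> \bar R)].

End Measures.

(** * Definable addition *)

Section Addition.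
Variables (L : language) (theta : formula L 3) (M : structure L).

Definition theta_sum (x y z : M) : Prop := sat M theta (tnth [tuple x; y; z]).

Definition comm_monoid_axioms : Prop :=
  [/\ forall x y, exists! z, theta_sum x y z,
      forall x y z, theta_sum x y z <-> theta_sum y x z,
      forall x y z w, (exists v, theta_sum x y v /\ theta_sum v z w) <->
                      (exists u, theta_sum y z u /\ theta_sum x u w) &
      exists x, forall y, theta_sum x y y].

(* The set of x such that phi(x + y). *)
Definition translate (phi : formula (add_constants L M) 1) (y : M) : set M :=
  [set x | exists z, theta_sum x y z /\ solset phi z].

Definition convolution (R : realType) (K : Type)
    (mu nu : probability (definable_space K M) R)
    (phi : formula (add_constants L M) 1) : \bar R :=
  (\int[nu]_y mu (translate phi y))%E.

End Addition.

(* Main.v *)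
(* The convolution of mu and nu is finitely additive on the definable sets, and
   any finitely additive probability m on them extends.  Let U be "open" if it
   is a union of sets definable over a common small set of parameters, and put
   m(U) = sup of m(X) over definable X contained in U.  Saturation makes
   definable sets compact for open covers, so m*(E) = inf of m(U) over open U
   containing E is an outer measure, and all open sets are Caratheodory
   measurable.  The extension is unique because, up to null sets, every
   measurable set lies in the sigma-algebra generated by the definable sets.

   For the countable definability of the convolution, the countably generated
   sigma-algebra given by mu on pairs (y, ys) is generated by countably many
   C-definable sets, closed under intersection; the nu-measures of their
   sections at ys are measurable for one countably generated sigma-algebra
   given by nu, and a Dynkin argument passes this on to the integral in y. *)
Require Import Defs.
From HB Require Import structures.
From mathcomp Require Import all_boot all_order all_algebra.
From mathcomp Require Import all_classical all_reals all_analysis.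
From mathcomp Require Import measurable_realfun.

Set Implicit Arguments.
Unset Strict Implicit.
Unset Printing Implicit Defensive.

Local Open Scope classical_set_scope.

Import Order.TTheory GRing.Theory Num.Theory.

(** * Syntax *)

(* [all_analysis] exports another [eval]. *)
Local Notation eval := Defs.eval.

Lemma vcons0 T n (a : T) (v : 'I_n -> T) : vcons a v ord0 = a.
Proof. by rewrite /vcons unlift_none. Qed.

Lemma vcons_lift T n (a : T) (v : 'I_n -> T) k : vcons a v (lift ord0 k) = v k.
Proof. by rewrite /vcons liftK. Qed.

Lemma eq_vcons T n (a : T) (v : 'I_n -> T) (w : 'I_n.+1 -> T) :
  w ord0 = a -> (forall k, w (lift ord0 k) = v k) -> w = vcons a v.
Proof.
move=> w0 wS; apply/funext => k; case: (unliftP ord0 k) => [k'|] ->.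
  by rewrite vcons_lift wS.
by rewrite vcons0 w0.
Qed.

Lemma comp_vcons T U (f : T -> U) n (a : T) (v : 'I_n -> T) :
  f \o vcons a v = vcons (f a) (f \o v).
Proof. by apply: eq_vcons => [|k] /=; rewrite ?vcons0 ?vcons_lift. Qed.

Lemma vcat_lshift T p q (a : 'I_p -> T) (b : 'I_q -> T) k :
  vcat a b (lshift q k) = a k.
Proof. by rewrite /vcat (unsplitK (inl _ k)). Qed.

Lemma vcat_rshift T p q (a : 'I_p -> T) (b : 'I_q -> T) k :
  vcat a b (rshift p k) = b k.
Proof. by rewrite /vcat (unsplitK (inr _ k)). Qed.

Lemma lshift_lift n k (j : 'I_n) :
  lshift k (lift ord0 j) = lift ord0 (lshift k j) :> 'I_(n + k).+1.
Proof. exact: val_inj. Qed.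

Lemma rshift_lift n k (j : 'I_k) :
  rshift n.+1 j = lift ord0 (rshift n j) :> 'I_(n + k).+1.
Proof. exact: val_inj. Qed.

(** The index types agree because [n.+1 + k] reduces to [(n + k).+1]. With parameters appended at
    the end, passing under a quantifier thus needs no cast. *)
Lemma vcat_vcons T n k (a : T) (v : 'I_n -> T) (w : 'I_k -> T) :
  vcat (vcons a v) w = vcons a (vcat v w) :> ('I_(n + k).+1 -> T).
Proof.
apply: eq_vcons => [|j].
  rewrite (_ : ord0 = lshift k (ord0 : 'I_n.+1)); last exact: val_inj.
  by rewrite vcat_lshift vcons0.
case: (splitP j) => j' jj'.
  rewrite (_ : j = lshift k j'); last exact: val_inj.
  by rewrite vcat_lshift -lshift_lift vcat_lshift vcons_lift.
rewrite (_ : j = rshift n j'); last exact: val_inj.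
by rewrite vcat_rshift -rshift_lift vcat_rshift.
Qed.

(** * Renaming of variables *)

Section Renaming.
Variable L : language.

Fixpoint tren m n (r : 'I_m -> 'I_n) (t : term L m) : term L n :=
  match t with
  | Var i => Var L (r i)
  | App f ts => App (fun k => tren r (ts k))
  end.

(** The target arity and the renaming come after [phi] because the recursion changes them under a
    quantifier. *)
Fixpoint fren m (phi : formula L m) :
    forall n, ('I_m -> 'I_n) -> formula L n :=
  match phi in formula _ m return forall n, ('I_m -> 'I_n) -> formula L n with
  | FEq _ s t => fun n r => FEq (tren r s) (tren r t)
  | FRel _ R ts => fun n r => FRel (fun k => tren r (ts k))
  | FNot _ f => fun n r => FNot (fren f r)
  | FAnd _ f g => fun n r => FAnd (fren f r) (fren g r)
  | FEx _ f => fun n r => FEx (fren f (vcons ord0 (lift ord0 \o r)))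
  end.

Variable M : structure L.

Lemma eval_tren m n (r : 'I_m -> 'I_n) (v : 'I_n -> M) (t : term L m) :
  eval v (tren r t) = eval (v \o r) t.
Proof. by elim: t => //= f ts IH; congr fint; apply/funext. Qed.

Lemma sat_fren m (phi : formula L m) n (r : 'I_m -> 'I_n) (v : 'I_n -> M) :
  sat M (fren phi r) v <-> sat M phi (v \o r).
Proof.
elim: phi n r v => {m} [m s t|m R ts|m f IH|m f IHf g IHg|m f IH] n r v /=.
- by rewrite !eval_tren.
- by under eq_fun do rewrite eval_tren.
- by rewrite IH.
- by rewrite IHf IHg.
- suff E a : vcons a v \o vcons ord0 (lift ord0 \o r) = vcons a (v \o r).
    by split=> -[a]; [rewrite IH E|move=> h]; exists a => //; rewrite IH E.
  rewrite comp_vcons vcons0; congr vcons.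
  by apply/funext => k /=; rewrite vcons_lift.
Qed.

End Renaming.

(** * Substitution of constants for variables *)

Section Instantiation.
Variables (L : language) (C : Type).
Notation LC := (add_constants L C).

Definition tconst n (c : C) : term LC n :=
  @App LC n (inr c) (fun k : 'I_0 => match notF (ltn_ord k) with end).

Fixpoint tinst m n (r : 'I_m -> 'I_n + C) (t : term L m) : term LC n :=
  match t with
  | Var i => match r i with inl k => Var LC k | inr c => tconst n c end
  | App f ts => @App LC n (inl f) (fun k => tinst r (ts k))
  end.

Definition lift_inst m n (r : 'I_m -> 'I_n + C) : 'I_m.+1 -> 'I_n.+1 + C :=
  vcons (inl ord0)
    (fun k => match r k with inl k' => inl (lift ord0 k') | inr c => inr c end).

Fixpoint finst m (phi : formula L m) :
    forall n, ('I_m -> 'I_n + C) -> formula LC n :=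
  match phi in formula _ m
  return forall n, ('I_m -> 'I_n + C) -> formula LC n with
  | FEq _ s t => fun n r => FEq (tinst r s) (tinst r t)
  | FRel _ R ts => fun n r => @FRel LC n R (fun k => tinst r (ts k))
  | FNot _ f => fun n r => FNot (finst f r)
  | FAnd _ f g => fun n r => FAnd (finst f r) (finst g r)
  | FEx _ f => fun n r => FEx (finst f (lift_inst r))
  end.

Variables (M : structure L) (i : C -> M).

Definition inst_val n (v : 'I_n -> M) (x : 'I_n + C) : M :=
  match x with inl k => v k | inr c => i c end.

Lemma eval_tinst m n (r : 'I_m -> 'I_n + C) (v : 'I_n -> M) (t : term L m) :
  eval (M := expansion i) v (tinst r t) = eval (inst_val v \o r) t.
Proof.
elim: t => [k|f ts IH] /=; first by case: (r k).
by congr fint; apply/funext.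
Qed.

Lemma sat_finst m (phi : formula L m) n (r : 'I_m -> 'I_n + C) (v : 'I_n -> M) :
  sat (expansion i) (finst phi r) v <-> sat M phi (inst_val v \o r).
Proof.
elim: phi n r v => {m} [m s t|m R ts|m f IH|m f IHf g IHg|m f IH] n r v /=.
- by rewrite !eval_tinst.
- by under eq_fun do rewrite eval_tinst.
- by rewrite IH.
- by rewrite IHf IHg.
- suff E a : inst_val (vcons a v) \o lift_inst r = vcons a (inst_val v \o r).
    by split=> -[a]; [rewrite IH E|move=> h]; exists a => //; rewrite IH E.
  rewrite comp_vcons /= vcons0; congr vcons; apply/funext => k /=.
  by case: (r k) => //= k'; rewrite vcons_lift.
Qed.

End Instantiation.

(** * Replacement of constants by variables *)

Section ConstantsToVariables.
Variables (L : language) (C : Type).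
Notation LC := (add_constants L C).

Fixpoint tparams n (t : term LC n) : set C :=
  match t with
  | Var _ => set0
  | App f ts => match f with inl _ => set0 | inr c => [set c] end `|`
                \bigcup_k tparams (ts k)
  end.

Fixpoint fparams n (phi : formula LC n) : set C :=
  match phi with
  | FEq _ s t => tparams s `|` tparams t
  | FRel _ R ts => \bigcup_k tparams (ts k)
  | FNot _ f => fparams f
  | FAnd _ f g => fparams f `|` fparams g
  | FEx _ f => fparams f
  end.

Lemma finite_tparams n (t : term LC n) : finite_set (tparams t).
Proof.
elim: t => [//|f ts IH] /=; rewrite finite_setU; split; first by case: f {ts IH}.
exact: bigcup_finite.
Qed.

Lemma finite_fparams n (phi : formula LC n) : finite_set (fparams phi).
Proof.
elim: phi => {n} //= [n s t|n R ts|n f IHf g IHg].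
- by rewrite finite_setU; split; apply: finite_tparams.
- by apply: bigcup_finite => // k _; apply: finite_tparams.
- by rewrite finite_setU.
Qed.

Variables (k : nat) (idx : C -> 'I_k).

(* Variables keep their index, and the constant [c] becomes the variable
   [n + idx c]; then a quantifier needs no renaming. *)
Fixpoint textr n (t : term LC n) : term L (n + k) :=
  match t with
  | Var j => Var L (lshift k j)
  | App f ts =>
    match f as f return ('I_(@far LC f) -> term L (n + k)) -> term L (n + k) with
    | inl f => @App L (n + k) f
    | inr c => fun=> Var L (rshift n (idx c))
    end (fun j => textr (ts j))
  end.

Fixpoint fextr n (phi : formula LC n) : formula L (n + k) :=
  match phi with
  | FEq _ s t => FEq (textr s) (textr t)
  | FRel n R ts => @FRel L (n + k) R (fun k => textr (ts k))
  | FNot _ f => FNot (fextr f)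
  | FAnd _ f g => FAnd (fextr f) (fextr g)
  | FEx _ f => FEx (fextr f)
  end.

Variables (M : structure L) (i : C -> M) (c : 'I_k -> C).

(** As [idx] has finite range, [c] can be required to invert it only on the constants that occur in
    the term. *)
Lemma eval_textr n (t : term LC n) (v : 'I_n -> M) :
    (forall x, tparams t x -> c (idx x) = x) ->
  eval (vcat v (i \o c)) (textr t) = eval (M := expansion i) v t.
Proof.
elim: t => [j|[f|x] ts IH] /= ct; first by rewrite vcat_lshift.
- congr fint; apply/funext => j; apply: IH => x tx; apply: ct.
  by right; exists j.
- by rewrite vcat_rshift /= ct//; left.
Qed.

Lemma sat_fextr n (phi : formula LC n) (v : 'I_n -> M) :
    (forall x, fparams phi x -> c (idx x) = x) ->
  sat M (fextr phi) (vcat v (i \o c)) <-> sat (expansion i) phi v.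
Proof.
elim: phi v => {n} [n s t|n R ts|n f IH|n f IHf g IHg|n f IH] v /= cphi.
- by rewrite !eval_textr// => x ?; apply: cphi; [right|left].
- suff -> : (fun j => eval (vcat v (i \o c)) (textr (ts j))) =
     (fun j => eval (M := expansion i) v (ts j)) by [].
  by apply/funext => j; apply: eval_textr => x tx; apply: cphi; exists j.
- by rewrite IH.
- by rewrite IHf ?IHg// => x ?; apply: cphi; [right|left].
- by split=> -[a fa]; exists a; move: fa; rewrite -vcat_vcons IH.
Qed.

End ConstantsToVariables.

(** A formula contains finitely many constants, so they can be moved into a tuple of parameters.
    From here on the arguments use [L]-formulas with parameters instead of the expanded language. *)
Lemma definableP L (M : structure L) (C : pointedType) (i : C -> M) n
    (X : set ('I_n -> M)) :
  definable i n X <-> exists k (psi : formula L (n + k)) (c : 'I_k -> C),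
    X = [set v | sat M psi (vcat v (i \o c))].
Proof.
split=> [[phi _ <-]|[k [psi [c ->]]]].
  have /finite_seqP[s phis] := finite_fparams phi.
  (* The extra entry [point] makes the index type nonempty, as [inord] requires, even when [phi] has
     no constants. *)
  pose c (j : 'I_(size s).+1) := nth point (rcons s point) j.
  exists (size s).+1, (fextr (fun x => inord (index x s)) phi), c.
  apply/seteqP; split=> v /=; rewrite sat_fextr// => x; rewrite phis /= /c => xs;
    by rewrite inordK ?ltnS ?index_size// nth_rcons index_mem xs nth_index.
exists (finst psi
   (fun j => match fintype.split j with inl j => inl j | inr j => inr (c j) end)) => //.
apply/seteqP; split=> v /=; rewrite sat_finst;
  rewrite (_ : inst_val _ _ \o _ = vcat v (i \o c))//;
  by apply/funext => j; rewrite /vcat/=; case: fintype.split.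
Qed.

(** The parameter set [D] is explicit so that families of sets definable over one common small set
    can be handled, as saturation demands. *)
Definition mdef L (M : structure L) (D : set M) (X : set M) :=
  exists k (psi : formula L k.+1) (c : 'I_k -> M),
    (forall j, D (c j)) /\ X = [set a | sat M psi (vcons a c)].

Lemma vcat1 T k (a : T) (c : 'I_k -> T) :
  vcat (fun _ : 'I_1 => a) c = vcons a c.
Proof.
rewrite (_ : (fun=> a) = vcons a (fun j : 'I_0 => a)); last first.
  by apply: eq_vcons.
rewrite vcat_vcons; congr vcons; apply/funext => j.
rewrite (_ : j = rshift 0 j); last exact: val_inj.
by rewrite vcat_rshift; congr c; apply: val_inj.
Qed.

Lemma range_solsetP L (M : structure L) (X : set M) :
  range (@solset L M) X <-> mdef [set: M] X.
Proof.
split=> [[phi _ <-]|[k [psi [c [_ ->]]]]].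
  have /definableP[k [psi [c E]]] : definable (M := M) (@id M) 1
      [set v | sat (expansion (M := M) id) phi v].
    by exists phi.
  have Ea (a : M) : sat (expansion (M := M) id) phi (fun=> a) =
      @sat L M (1 + k) psi (vcat (fun=> a) c).
    exact: (congr1 (fun X => X (fun=> a)) E).
  exists k, psi, c; split=> //; apply/seteqP; split=> a;
    by rewrite /solset /= Ea vcat1.
have /definableP[phi _ E] : exists k' (psi' : formula L (1 + k')) (c' : 'I_k' -> M),
    [set v : 'I_1 -> M | sat M psi (vcat v c)] =
    [set v | sat M psi' (vcat v (id \o c'))] by exists k, psi, c.
have Ea (a : M) : sat (expansion (M := M) id) phi (fun=> a) =
      @sat L M (1 + k) psi (vcat (fun=> a) c).
  exact: (congr1 (fun X => X (fun=> a)) E).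
exists phi => //; apply/seteqP; split=> a;
  by rewrite /solset /= Ea vcat1.
Qed.

(** * Definable sets and translates *)

Section DefinableSets.
Variables (L : language) (M : structure L).

Lemma sub_mdef (D D' : set M) : D `<=` D' -> mdef D `<=` mdef D'.
Proof.
by move=> DD' X [k [psi [c [cD ->]]]]; exists k, psi, c; split=> // j; apply: DD'.
Qed.

Lemma mdefT D : mdef D [set: M].
Proof.
exists 0, (FEq (Var L ord0) (Var L ord0)), (fun=> point); split=> [[]//|].
exact/seteqP.
Qed.

Lemma mdefC D (X : set M) : mdef D X -> mdef D (~` X).
Proof. by move=> [k [psi [c [cD ->]]]]; exists k, (FNot psi), c. Qed.

Lemma mdefI D (X Y : set M) : mdef D X -> mdef D Y -> mdef D (X `&` Y).
Proof.
move=> [k [psi [c [cD ->]]]] [k' [psi' [c' [cD' ->]]]].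
(* Both renamings fix variable 0; they send the two parameter tuples to consecutive blocks. *)
pose r : 'I_k.+1 -> 'I_(k + k').+1 := vcons ord0 (lift ord0 \o @lshift k k').
pose r' : 'I_k'.+1 -> 'I_(k + k').+1 := vcons ord0 (lift ord0 \o @rshift k k').
exists (k + k')%N, (FAnd (fren psi r) (fren psi' r')), (vcat c c'); split.
  by move=> j; rewrite /vcat; case: fintype.split.
have E a : vcons a (vcat c c') \o r = vcons a c.
  rewrite comp_vcons vcons0; congr vcons; apply/funext => j /=.
  by rewrite vcons_lift vcat_lshift.
have E' a : vcons a (vcat c c') \o r' = vcons a c'.
  rewrite comp_vcons vcons0; congr vcons; apply/funext => j /=.
  by rewrite vcons_lift vcat_rshift.
by apply/seteqP; split=> a /=; rewrite !sat_fren E E'.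
Qed.

Lemma mdefU D (X Y : set M) : mdef D X -> mdef D Y -> mdef D (X `|` Y).
Proof.
move=> dX dY; rewrite -(setCK (X `|` Y)) setCU.
by apply/mdefC/mdefI; apply/mdefC.
Qed.

Lemma mdef0 D : mdef D (@set0 M).
Proof. by rewrite -setCT; exact/mdefC/mdefT. Qed.

Lemma mdefD D (X Y : set M) : mdef D X -> mdef D Y -> mdef D (X `\` Y).
Proof. by move=> dX dY; rewrite setDE; exact/mdefI/mdefC. Qed.

Lemma mdef_bigsetU D I (s : seq I) (P : pred I) (F : I -> set M) :
  (forall x, P x -> mdef D (F x)) -> mdef D (\big[setU/set0]_(x <- s | P x) F x).
Proof.
by move=> dF; elim/big_ind: _ => //; [exact: mdef0|move=> *; exact: mdefU].
Qed.

Lemma mdef_finite_params D (X : set M) : mdef D X ->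
  exists2 D', finite_set D' /\ D' `<=` D & mdef D' X.
Proof.
move=> [k [psi [c [cD ->]]]]; exists (range c); last by exists k, psi, c.
split; last by move=> _ [j _ <-].
exact/finite_image/finite_finset.
Qed.

Variables (C : pointedType) (i : C -> M).

Lemma definableI n : setI_closed (definable i n).
Proof. by move=> _ _ [f _ <-] [g _ <-]; exists (FAnd f g). Qed.

Lemma definableT n : definable i n setT.
Proof.
exists (FEx (FEq (Var _ ord0) (Var _ ord0))) => //.
by apply/seteqP; split=> // v _ /=; exists point.
Qed.

Lemma mdef_vcons n (ys : 'I_n -> M) (X : set ('I_n.+1 -> M)) :
  definable i n.+1 X -> mdef [set: M] [set x | X (vcons x ys)].
Proof.
move=> /definableP[k [psi [c ->]]].
exists (n + k)%N, psi, (vcat ys (i \o c)); split=> //.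
by apply/seteqP; split=> x /=; rewrite vcat_vcons.
Qed.

(** Fixing the last [k] variables at elements of [C] keeps a set definable over [C]. This lets
    constants be treated first as variables and be specialized afterwards. *)
Lemma definable_vcat n k (c : 'I_k -> C) (X : set ('I_(n + k) -> M)) :
  definable i (n + k) X -> definable i n [set ys | X (vcat ys (i \o c))].
Proof.
move=> /definableP[k' [psi [c' ->]]].
exists (finst psi (fun j => match fintype.split j with
  | inl j => match fintype.split j with inl j => inl j | inr j => inr (c j) end
  | inr j => inr (c' j) end)) => //.
apply/seteqP; split=> v /=; rewrite sat_finst;
  rewrite (_ : inst_val _ _ \o _ = vcat (vcat v (i \o c)) (i \o c'))//;
  apply/funext => j; rewrite /vcat/=;
  by case: fintype.split => // j'; case: fintype.split.
Qed.

End DefinableSets.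

Lemma comp_tnth3 T U (f : T -> U) x y z :
  f \o tnth [tuple x; y; z] = tnth [tuple f x; f y; f z].
Proof.
by apply/funext => -[[|[|[|]]] //= ?]; rewrite !(tnth_nth (x)) ?(tnth_nth (f x)).

Qed.

(** * Translates under the definable addition *)

Section Addition.
Variables (L : language) (theta : formula L 3).

Definition theta_fun (M : structure L) := forall x y : M,
  exists2 z, theta_sum theta x y z & forall z', theta_sum theta x y z' -> z' = z.

(** Functionality of [theta] is expressed by the sentence [s], in which universal quantifiers are
    negated existential ones. *)
Lemma theta_fun_elementary (M N : structure L) (j : M -> N) :
  elementary_embedding j -> theta_fun M -> theta_fun N.
Proof.
(* These are the de Bruijn indices 3, 2 and 1. In [ex] the variables 0, 1, 2 stand for z, y, x; in
   [unique] a competitor z' takes index 0 and z, y, x move up by one. *)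
pose o3 m : 'I_m.+4 := lift ord0 (lift ord0 (lift ord0 ord0)).
pose o2 m : 'I_m.+3 := lift ord0 (lift ord0 ord0).
pose o1 m : 'I_m.+2 := lift ord0 ord0.
pose unique : formula L 4 :=
  FAnd (fren theta (tnth [tuple o3 0; o2 1; ord0]))
       (FNot (FEq (Var L ord0) (Var L (o1 2)))).
pose ex : formula L 3 :=
  FAnd (fren theta (tnth [tuple o2 0; o1 1; ord0])) (FNot (FEx unique)).
pose s : formula L 0 := FNot (FEx (FEx (FNot (FEx ex)))).
suff sP (P : structure L) : sat P s (fun=> point) <-> theta_fun P.
  move=> /(_ _ s) je; rewrite -!sP je.
  by rewrite (_ : j \o _ = (fun=> point))//; apply/funext => -[].
have exP (x y z : P) : sat P ex (vcons z (vcons y (vcons x (fun=> point)))) <->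
    theta_sum theta x y z /\ forall z', theta_sum theta x y z' -> z' = z.
  rewrite /= sat_fren comp_tnth3 /o2 /o1 !(vcons_lift, vcons0).
  split=> -[xyz uz]; split=> //.
    move=> z' xyz'; apply: contrapT => z'z; apply: uz; exists z'.
    by rewrite sat_fren comp_tnth3 /o3 /o2 /o1 !(vcons_lift, vcons0).
  move=> [z']; rewrite sat_fren comp_tnth3 /o3 /o2 /o1 !(vcons_lift, vcons0).
  by move=> [/uz].
split=> [/= h x y|h /= [x [y []]]].
  apply: contrapT => nz; apply: h; exists x, y => -[z] /exP[xyz uz].
  by apply: nz; exists z.
by have [z xyz uz] := h x y; exists z; apply/exP.
Qed.

Variable M : structure L.

(** This is [translate] as an operation on sets; the two agree by conversion for X =
    [solset phi]. *)
Definition shift_set (X : set M) (y : M) : set M :=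
  [set x | exists z, theta_sum theta x y z /\ X z].

(** Under the quantifier the variables 0, 1, 2 are z, x, y with x + y = z, and the parameters of
    [phi] start at index 3. *)
Definition shift_formula n (phi : formula L n.+1) : formula L n.+2 :=
  FEx (FAnd (fren theta
               (tnth [tuple lift ord0 ord0; lift ord0 (lift ord0 ord0); ord0]))
            (fren phi (vcons ord0 (lift ord0 \o lift ord0 \o lift ord0)))).

Lemma sat_shift_formula n (phi : formula L n.+1) x y (c : 'I_n -> M) :
  sat M (shift_formula phi) (vcons x (vcons y c)) <->
  shift_set [set a | sat M phi (vcons a c)] y x.
Proof.
rewrite /shift_formula/=; split=> -[z] h; exists z; move: h;
rewrite !sat_fren comp_tnth3 !(vcons_lift, vcons0);
rewrite (_ : vcons z _ \o _ = vcons z c)//;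
  rewrite comp_vcons vcons0; congr vcons; apply/funext => j /=;
  by rewrite !vcons_lift.
Qed.

Hypothesis fM : theta_fun M.

Lemma shift_setT y : shift_set setT y = setT.
Proof.
by apply/seteqP; split=> x // _; have [z xyz _] := fM x y; exists z.
Qed.

Lemma shift_setU X Y y : shift_set (X `|` Y) y = shift_set X y `|` shift_set Y y.
Proof.
apply/seteqP; split=> x /=; first by move=> [z [xyz [Xz|Yz]]]; [left|right]; exists z.
by move=> [|] [z [xyz ?]]; exists z; split=> //; [left|right].
Qed.

(** Uniqueness of the sum identifies the two witnesses z. Translation hence preserves
    disjointness. *)
Lemma shift_setI X Y y : shift_set (X `&` Y) y = shift_set X y `&` shift_set Y y.
Proof.
apply/seteqP; split=> x /=; first by move=> [z [xyz [Xz Yz]]]; split; exists z.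
move=> [[z [xyz Xz]] [z' [xyz' Yz']]]; exists z; do 2!split => //.
by have [w _ uw] := fM x y; rewrite (uw _ xyz) -(uw _ xyz').
Qed.

Lemma shift_set0 y : shift_set set0 y = set0.
Proof. by apply/seteqP; split=> x // [z []]. Qed.

End Addition.

(** * Saturation *)

Lemma sub_small K T U (A : set T) (B : set U) :
  (A #<= B)%card -> small K B -> small K A.
Proof.
move=> AB [BK KB]; split; first exact: card_le_trans BK.
by move=> KA; apply: KB; exact: card_le_trans AB.
Qed.

(** Regularity of [K] is stated for subsets of [K] indexed by a subset of [K]; the injections [f]
    and [h] carry the index set and the union into [K]. *)
Lemma small_bigcup K T U (I : set T) (F : T -> set U) :
    uncountable_inaccessible K -> ([set: U] #<= [set: K])%card -> small K I ->
    (forall x, I x -> small K (F x)) ->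
  small K (\bigcup_(x in I) F x).
Proof.
elim/Ppointed: K => K [nK regK _] UK IK FK.
  by case: nK; rewrite emptyE_subdef.
have [h hinj] := pcard_injP UK; have [f finj] := pcard_injP IK.1.
(* Since [f] is injective on [I], at most one index x contributes to [F' k], which is therefore
   small. *)
pose F' k := h @` \bigcup_(x in I `&` f @^-1` [set k]) F x.
have h_eq (A : set U) : (h @` A #= A)%card.
  by apply: inj_card_eq => x y _ _; apply: hinj; rewrite inE.
have sub : (\bigcup_(x in I) F x #<= \bigcup_(k in f @` I) F' k)%card.
  rewrite -(card_le_eql (h_eq _)); apply: subset_card_le => _ [u [x Ix Fu] <-].
  by exists (f x); [exists x|exists u => //; exists x].
apply: sub_small sub _; apply: regK.
  by apply: sub_small IK; exact: card_image_le.
move=> _ [x Ix <-]; apply: sub_small (FK _ Ix).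
rewrite (card_le_eql (h_eq _)); apply: subset_card_le => u [y [Iy fxy]].
by rewrite (finj y x) ?inE.
Qed.

Section Inaccessible.
Variables (K : Type) (hK : uncountable_inaccessible K).

Lemma countable_small T (A : set T) : countable A -> small K A.
Proof.
case: hK => nK _ _ cA; split.
  apply: card_le_trans cA _; apply/infiniteP => /finite_set_countable.
  exact: nK.
by move=> KA; apply/nK/(card_le_trans KA).
Qed.

End Inaccessible.

Section Saturation.
Variables (L : language) (M : structure L) (satM : saturated M).

(** Saturation is applied to the type of all formulas over [D] whose solution set belongs to [S]; a
    finite part of this type has finitely many solution sets. *)
Lemma saturated_bigcap (D : set M) (S : set (set M)) :
    card_lt D [set: M] -> S `<=` mdef D ->
    (forall Q, Q `<=` S -> finite_set Q -> \bigcap_(X in Q) X !=set0) ->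
  \bigcap_(X in S) X !=set0.
Proof.
move=> Dlt SD fip.
pose sol (phi : formula (add_constants L D) 1) : set M :=
  [set a | sat (expansion (M := M) (@set_val M D)) phi (fun=> a)].
have [a ha] : exists a : M, forall phi, S (sol phi) -> sol phi a.
  apply: satM Dlt [set phi | S (sol phi)] _ => q qS finq.
  have [|a qa] := fip (sol @` q) _ (finite_image sol finq).
    by move=> _ [phi /qS ? <-].
  by exists a => phi qphi; apply: (qa (sol phi)); exists phi.
exists a => X SX; have [k [psi [c [cD XE]]]] := SD _ SX.
pose r : 'I_k.+1 -> 'I_1 + D :=
  vcons (inl ord0) (fun j => inr (SigSub (mem_set (cD j)))).
suff E : sol (finst psi r) = X by rewrite -E; apply: ha; rewrite E.
rewrite XE; apply/seteqP; split=> b; rewrite /sol/= sat_finst;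
  rewrite (_ : inst_val _ _ \o r = vcons b c)//;
  rewrite comp_vcons; congr vcons; exact/funext.
Qed.

Variables (K : Type) (hK : uncountable_inaccessible K).
Hypothesis hcard : ([set: M] #= [set: K])%card.

Lemma small_card_lt T (A : set T) : small K A -> card_lt A [set: M].
Proof. by rewrite /card_lt (card_le_eqr hcard) (card_le_eql hcard). Qed.

Lemma small_bigcup_M T (I : set T) (F : T -> set M) :
  small K I -> (forall x, I x -> small K (F x)) -> small K (\bigcup_(x in I) F x).
Proof. by apply: small_bigcup => //; rewrite (card_le_eql hcard). Qed.

Lemma smallU (D D' : set M) : small K D -> small K D' -> small K (D `|` D').
Proof.
move=> sD sD'; rewrite -bigcup2E; apply: small_bigcup_M.
  exact: countable_small.
move=> [|[|n]] _ //=.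
by apply: countable_small.
Qed.

(** If no finite part of [S] covers X, then X and the sets X \ Y, for Y in [S], have the finite
    intersection property. They are definable over [D] and the finitely many parameters of X. *)
Lemma saturated_compact (D : set M) (S : set (set M)) (X : set M) :
    small K D -> S `<=` mdef D -> mdef [set: M] X -> X `<=` \bigcup_(Y in S) Y ->
  exists s : seq (set M), (forall Y, Y \in s -> S Y) /\ X `<=` \bigcup_(Y in [set` s]) Y.
Proof.
move=> sD SD /mdef_finite_params[D' [finD' _] dX] XS; apply: contrapT => ncov.
have sDD' : small K (D `|` D').
  by apply: smallU => //; exact/countable_small/finite_set_countable.
pose S' := [set X `\` Y | Y in S].
suff [] : \bigcap_(Y in X |` S') Y !=set0.
  move=> a Sa; have /XS[Y SY Ya] : X a by apply: Sa; left.
  by have [] : (X `\` Y) a by apply: Sa; right; exists Y.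
apply: saturated_bigcap (small_card_lt sDD') _ _.
  have {}dX : mdef (D `|` D') X by apply: sub_mdef dX; exact: subsetUr.
  move=> _ [->//|[Y SY <-]]; apply: mdefD => //.
  by apply: sub_mdef (SD _ SY); exact: subsetUl.
move=> Q QS finQ; apply: contrapT => Q0; apply: ncov.
(* [f] recovers some Z in [S] from X \ Z. The set Q may also contain X itself, where [f] can return
   the default [set0]; this is why the list is filtered by [S] below. *)
pose f Y := xget set0 [set Z | S Z /\ Y = X `\` Z].
have /finite_seqP[s sE] := finite_image f finQ.
exists [seq Z <- s | `[< S Z >] ]; split=> [Y|x Xx].
  by rewrite mem_filter => /andP[/asboolP].
apply: contrapT => nx; apply: Q0; exists x => Y QY.
have [->//|[Z SZ ZY]] := QS _ QY.
have [SfY fYE] : S (f Y) /\ Y = X `\` f Y.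
  by apply: (xgetI set0 (P := [set Z | S Z /\ Y = X `\` Z]) (x := Z)).
rewrite fYE; split=> // fYx; apply: nx; exists (f Y) => //=.
rewrite mem_filter asboolT//=; suff : [set` s] (f Y) by [].
by rewrite -sE; exists Y.
Qed.

(* A union of sets definable over one small set of parameters; the number of
   sets in the union is not bounded, which spares counting formulas. *)
Definition dopen (U : set M) := exists2 D, small K D &
  exists2 S : set (set M), S `<=` mdef D & U = \bigcup_(X in S) X.

Lemma mdef_dopen X : mdef [set: M] X -> dopen X.
Proof.
move=> /mdef_finite_params[D [finD _] dX]; exists D.
  exact/countable_small/finite_set_countable.
by exists [set X]; [move=> _ ->|rewrite bigcup_set1].
Qed.

Lemma small_params (S : set (set M)) :
  small K S -> S `<=` mdef [set: M] -> exists2 D, small K D & S `<=` mdef D.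
Proof.
move=> sS Sdef.
have /choice[D DP] : forall X, exists D : set M, S X -> finite_set D /\ mdef D X.
  move=> X; have [/Sdef/mdef_finite_params[D [? _] ?]|nSX] := pselect (S X).
    by exists D.
  by exists set0.
exists (\bigcup_(X in S) D X).
  apply: small_bigcup_M => // X /DP[finD _].
  exact/countable_small/finite_set_countable.
move=> X SX; have [_] := DP _ SX.
by apply: sub_mdef; exact: bigcup_sup.
Qed.

Lemma dopen_bigcup (S : set (set M)) :
  small K S -> S `<=` mdef [set: M] -> dopen (\bigcup_(X in S) X).
Proof. by move=> sS /(small_params sS)[D sD SD]; exists D => //; exists S. Qed.

Lemma dopen_bigcupT (U : (set M)^nat) :
  (forall n, dopen (U n)) -> dopen (\bigcup_n U n).
Proof.
move=> /(_ _)/cid2-/all_sig2[D sD] /(_ _)/cid2-/all_sig2[S SD UE].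
exists (\bigcup_n D n).
  by apply: small_bigcup_M => //; exact: countable_small.
exists (\bigcup_n S n).
  move=> X [n _ SX]; apply: sub_mdef (SD _ _ SX).
  exact: (bigcup_sup (i := n)).
apply/seteqP; split=> [x [n _]|x [X [n _ SX] Xx]].
  by rewrite UE => -[X SX Xx]; exists X => //; exists n.
by exists n => //; rewrite UE; exists X.
Qed.

Lemma dopenI (U V : set M) : dopen U -> dopen V -> dopen (U `&` V).
Proof.
move=> [D sD [S SD ->]] [D' sD' [S' SD' ->]].
exists (D `|` D'); first exact: smallU.
exists [set Z | exists X Y, [/\ S X, S' Y & Z = X `&` Y]].
  move=> _ [X [Y [SX SY ->]]]; apply: mdefI.
    by apply: sub_mdef (SD _ SX); exact: subsetUl.
  by apply: sub_mdef (SD' _ SY); exact: subsetUr.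
apply/seteqP; split=> [x [[X SX Xx] [Y SY Yx]]|x [_ [X [Y [SX SY ->]] [Xx Yx]]]].
  by exists (X `&` Y) => //; exists X, Y.
by split; [exists X|exists Y].
Qed.

(** Compactness gives a finite cover by sets from the various families [S n]. Choosing one index
    [n_ Z] for each member Z and grouping by this index yields the sets [Y n]. *)
Lemma dopen_cover (U : (set M)^nat) X :
    (forall n, dopen (U n)) -> mdef [set: M] X -> X `<=` \bigcup_n U n ->
  exists (N : nat) (Y : (set M)^nat),
    [/\ forall n, mdef [set: M] (Y n), forall n, Y n `<=` U n &
        X `<=` \big[setU/set0]_(n < N) Y n].
Proof.
move=> /(_ _)/cid2-/all_sig2[D sD] /(_ _)/cid2-/all_sig2[S SD UE] dX XU.
have sDD : small K (\bigcup_n D n).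
  by apply: small_bigcup_M => //; exact: countable_small.
have [] := saturated_compact sDD (S := \bigcup_n S n) _ dX.
- move=> Z [n _ SZ]; apply: sub_mdef (SD _ _ SZ).
  exact: (bigcup_sup (i := n)).
- by move=> x /XU[n _]; rewrite UE => -[Z SZ Zx]; exists Z => //; exists n.
move=> s [sS Xs].
have /choice[n_ nP] : forall Z, exists n, Z \in s -> S n Z.
  move=> Z; have [/sS[n _ SZ]|Zs] := boolP (Z \in s); first by exists n.
  by exists 0%N.
pose Y n := \big[setU/set0]_(Z <- s | (Z \in s) && (n_ Z == n)) Z.
have YE n : Y n = \bigcup_(Z in [set Z | (Z \in s) && (n_ Z == n)]) Z.
  rewrite /Y -bigcup_seq_cond; apply/seteqP; split=> x [Z /= h Zx];
    exists Z => //=; first by case/andP: h.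
  by rewrite h; case/andP: h => ->.
exists (\max_(Z <- s) n_ Z).+1, Y; split.
- move=> n; apply: mdef_bigsetU => Z /andP[/nP SZ _].
  by apply: sub_mdef (SD _ _ SZ).
- move=> n; rewrite YE => x [Z /= /andP[Zs /eqP <-] Zx].
  by rewrite UE; exists Z => //; apply: nP.
- move=> x /Xs[Z /= Zs Zx].
  rewrite -(bigcup_mkord _ Y); exists (n_ Z) => /=.
    by rewrite ltnS; exact: leq_bigmax_seq.
  by rewrite YE; exists Z => //=; rewrite Zs eqxx.
Qed.

End Saturation.

(** * Extension of a compact content *)

Section Extension.
Local Open Scope ereal_scope.
Variables (R : realType) (T : Type) (D O : set (set T)) (m : set T -> \bar R).
Hypotheses (DT : D setT) (DI : setI_closed D) (DC : setC_closed D).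
Hypotheses (DO : D `<=` O) (OI : setI_closed O).
Hypothesis OU : forall U : (set T)^nat, (forall n, O (U n)) -> O (\bigcup_n U n).
Hypothesis O_cover : forall (U : (set T)^nat) X,
  (forall n, O (U n)) -> D X -> X `<=` \bigcup_n U n ->
  exists (N : nat) (Y : (set T)^nat),
    [/\ forall n, D (Y n), forall n, Y n `<=` U n &
        X `<=` \big[setU/set0]_(n < N) Y n].
Hypotheses (m0 : m set0 = 0) (m_ge0 : forall X, D X -> 0 <= m X).
Hypothesis mT : m setT < +oo.
Hypothesis mU : forall X Y, D X -> D Y -> X `&` Y = set0 ->
  m (X `|` Y) = m X + m Y.

Let D0 : D set0.
Proof. by rewrite -setCT; exact: DC. Qed.

Let DU X Y : D X -> D Y -> D (X `|` Y).
Proof. by move=> dX dY; rewrite -(setCK (_ `|` _)) setCU; apply/DC/DI; apply: DC. Qed.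

Let DD X Y : D X -> D Y -> D (X `\` Y).
Proof. by move=> dX dY; rewrite setDE; apply/DI => //; apply: DC. Qed.

Lemma content_le X Y : D X -> D Y -> X `<=` Y -> m X <= m Y.
Proof.
move=> dX dY XY; rewrite -(setDUK XY) mU ?setDIK//; last exact: DD.
by rewrite leeDl// m_ge0//; exact: DD.
Qed.

Lemma content_subadd X Y : D X -> D Y -> m (X `|` Y) <= m X + m Y.
Proof.
move=> dX dY; have dXY := DD (DU dX dY) dX.
rewrite -(setDUK (@subsetUl _ X Y)) mU ?setDIK// leeD2l// content_le//.
by move=> x [[]].
Qed.

Lemma content_bigsetU (Y : (set T)^nat) N : (forall n, D (Y n)) ->
  D (\big[setU/set0]_(n < N) Y n) /\
  m (\big[setU/set0]_(n < N) Y n) <= \sum_(n < N) m (Y n).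
Proof.
move=> dY; elim: N => [|N [dN IH]]; first by rewrite !big_ord0 m0.
rewrite !big_ord_recr/=; set Z := \big[setU/set0]_(n < N) Y n in dN IH *.
split; first exact: DU.
apply: le_trans (content_subadd dN (dY N)) _.
by rewrite leeD2r.
Qed.

(** [D] plays the role of the compact open sets and [O] that of the open sets, as in the
    construction of a Radon measure from a content. *)
Definition inner_content (U : set T) : \bar R :=
  ereal_sup [set m X | X in [set X | D X /\ X `<=` U]].

Definition outer_content (E : set T) : \bar R :=
  ereal_inf [set inner_content U | U in [set U | O U /\ E `<=` U]].

Lemma inner_content_ge U X : D X -> X `<=` U -> m X <= inner_content U.
Proof. by move=> dX XU; apply: ereal_sup_ubound; exists X. Qed.

Lemma inner_content_le U c :
  (forall X, D X -> X `<=` U -> m X <= c) -> inner_content U <= c.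
Proof. by move=> h; apply: ge_ereal_sup => _ [X [dX XU] <-]; exact: h. Qed.

Lemma inner_content_ge0 U : 0 <= inner_content U.
Proof. by rewrite -m0; exact: inner_content_ge. Qed.

Lemma inner_contentS U V : U `<=` V -> inner_content U <= inner_content V.
Proof.
move=> UV; apply: inner_content_le => X dX XU.
by apply: inner_content_ge => //; exact: subset_trans UV.
Qed.

Lemma inner_content_D X : D X -> inner_content X = m X.
Proof.
move=> dX; apply/eqP; rewrite eq_le inner_content_ge// andbT.
by apply: inner_content_le => Y dY; exact: content_le.
Qed.

Lemma outer_content_le E U : O U -> E `<=` U -> outer_content E <= inner_content U.
Proof. by move=> oU EU; apply: ereal_inf_lbound; exists U. Qed.

Lemma outer_content_O U : O U -> outer_content U = inner_content U.
Proof.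
move=> oU; apply/eqP; rewrite eq_le outer_content_le//=.
by apply: le_ereal_inf_tmp => _ [V [oV UV] <-]; exact: inner_contentS.
Qed.

Lemma outer_content_ge0 E : 0 <= outer_content E.
Proof.
by apply: le_ereal_inf_tmp => _ [U _ <-]; exact: inner_content_ge0.
Qed.

Lemma outer_content0 : outer_content set0 = 0.
Proof. by rewrite outer_content_O ?inner_content_D//; exact: DO. Qed.

Lemma outer_contentS : {homo outer_content : A B / A `<=` B >-> A <= B}.
Proof.
move=> A B AB; apply: le_ereal_inf_tmp => _ [U [oU BU] <-].
by apply: outer_content_le => //; exact: subset_trans BU.
Qed.

Lemma outer_content_fin E : outer_content E \is a fin_num.
Proof.
rewrite ge0_fin_numE ?outer_content_ge0//; apply: le_lt_trans mT.
by rewrite -inner_content_D//; apply: outer_content_le => //; exact: DO.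
Qed.

(** Compactness enters here: a set of [D] inside the union is covered by finitely many sets of [D],
    each inside one [U n], and finite subadditivity suffices. *)
Lemma inner_content_bigcup (U : (set T)^nat) : (forall n, O (U n)) ->
  inner_content (\bigcup_n U n) <= \sum_(n <oo) inner_content (U n).
Proof.
move=> oU; apply: inner_content_le => X dX XU.
have [N [Y [dY YU XY]]] := O_cover oU dX XU.
have [dN mN] := content_bigsetU N dY.
apply: le_trans (content_le dX dN XY) _; apply: le_trans mN _.
have -> : \sum_(n < N) m (Y n) = \sum_(0 <= n < N) m (Y n) by rewrite big_mkord.
apply: (@le_trans _ _ (\sum_(0 <= n < N) inner_content (U n))).
  by apply: lee_sum => n _; exact: inner_content_ge.
by apply: nneseries_lim_ge => n _ _; exact: inner_content_ge0.
Qed.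

Lemma outer_content_sigma_subadditive : sigma_subadditive outer_content.
Proof.
move=> E; apply/lee_addgt0Pr => e e0.
apply: le_trans (epsilon_trick _ _ (ltW e0)); last first.
  by move=> n; exact: outer_content_ge0.
have /choice[U UP] : forall n, exists U, [/\ O U, E n `<=` U &
    inner_content U <= outer_content (E n) + (e / (2 ^ n.+1)%:R)%:E].
  move=> n; have en0 : (0 < e / (2 ^ n.+1)%:R)%R.
    by rewrite divr_gt0// ltr0n expn_gt0.
  have [_ [U [oU EU] <-] Ue] := lb_ereal_inf_adherent en0 (outer_content_fin (E n)).
  by exists U; split=> //; exact: ltW.
apply: (@le_trans _ _ (inner_content (\bigcup_n U n))).
  apply: outer_content_le; first by apply: OU => n; have [] := UP n.
  by apply: subset_bigcup => n _; have [] := UP n.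
apply: le_trans (inner_content_bigcup _) _; first by move=> n; have [] := UP n.
apply: lee_nneseries => n; first by move=> _ _; exact: inner_content_ge0.
by move=> _; have [] := UP n.
Qed.

(** Let V be open around E. For X in [D] inside V [&] U, the set V \ X is open and contains E \ U.
    For Y in [D] inside V \ X, the disjoint union of X and Y lies in V; suprema over Y and then over
    X give the bound. *)
Lemma outer_content_caratheodory E U : O U ->
  outer_content (E `&` U) + outer_content (E `&` ~` U) <= outer_content E.
Proof.
move=> oU; apply: le_ereal_inf_tmp => _ [V [oV EV] <-].
rewrite -leeBrDr ?outer_content_fin//.
apply: (@le_trans _ _ (inner_content (V `&` U))).
  by apply: outer_content_le; [exact: OI|exact: setSI].
apply: inner_content_le => X dX XVU.
rewrite leeBrDr ?outer_content_fin//.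
have XV : X `<=` V by move=> x /XVU[].
apply: (@le_trans _ _ (m X + inner_content (V `&` ~` X))).
  rewrite leeD2l//; apply: outer_content_le.
    by apply: OI => //; exact/DO/DC.
  by move=> x [/EV Vx nUx]; split=> // /XVU[].
have Xfin : m X \is a fin_num.
  by rewrite ge0_fin_numE ?m_ge0//; apply: le_lt_trans mT; exact: content_le.
rewrite addeC -leeBrDr//; apply: inner_content_le => Y dY YVX.
rewrite leeBrDr// addeC -mU//.
  apply: inner_content_ge; first exact: DU.
  by rewrite subUset; split=> // x /YVX[].
by apply/seteqP; split=> x // [Xx /YVX[]].
Qed.

Lemma exists_outer_measure : exists mu : outer_measure R T,
  [/\ forall U, O U -> mu.-caratheodory U,
      forall X, D X -> mu X = m X &
      forall U, O U -> mu U = inner_content U].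
Proof.
pose mu : outer_measure R T := HB.pack outer_content
  (isOuterMeasure.Build R T outer_content outer_content0 outer_content_ge0
    outer_contentS outer_content_sigma_subadditive).
exists mu; split=> [U oU|X dX|U]; last exact: outer_content_O.
- by apply: le_caratheodory_measurable => E; exact: outer_content_caratheodory.
- by rewrite /= outer_content_O ?inner_content_D//; exact: DO.
Qed.

End Extension.

(** The Caratheodory sets form a sigma-algebra, so they include the one generated by [G], and the
    outer measure is sigma-additive on them. *)
Lemma exists_probability_caratheodory (R : realType) (T : pointedType)
    (mu : outer_measure R T) (G : set (set T)) :
    mu setT = 1%E -> G `<=` mu.-caratheodory ->
  exists P : probability (g_sigma_algebraType G) R,
    forall B, measurable B -> P B = mu B.
Proof.
move=> muT Gmu.
have sub : <<s G >> `<=` mu.-caratheodory.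
  apply: smallest_sub => //; exact: (@sigma_algebra_measurable _ (caratheodory_type mu)).
pose P : set (g_sigma_algebraType G) -> \bar R := mu.
have P0 : P set0 = 0%E by exact: outer_measure0.
have P_ge0 B : (0 <= P B)%E by exact: outer_measure_ge0.
have P_sigma : semi_sigma_additive P.
  move=> F mF tF mUF; apply: caratheodory_measure_sigma_additive => //.
    by move=> n; apply: sub; exact: mF.
  exact: sub.
pose P1 : {measure set (g_sigma_algebraType G) -> \bar R}%R := HB.pack P
  (isMeasure.Build _ _ _ P P0 P_ge0 P_sigma).
pose P2 : probability (g_sigma_algebraType G) R := HB.pack (Measure.sort P1)
  (Measure_isProbability.Build _ _ _ P1 muT).
by exists P2.
Qed.

(** * Generated sigma-algebras *)

(** The default [X0] fills the indices that enumerate nothing, so an empty [S] is allowed. It is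
    taken neutral: [set0] for unions, [setT] for intersections. *)
Lemma countable_enum T (S : set (set T)) (X0 : set T) : countable S ->
  exists h : (set T)^nat, S `<=` range h /\ range h `<=` X0 |` S.
Proof.
move=> /countable_injP[f finj].
exists (fun n => xget X0 [set X | S X /\ f X = n]); split=> [X SX|_ [n _ <-]].
  exists (f X) => //; apply: xget_unique => // Y [SY fXY].
  by apply: finj; rewrite ?inE.
by case: xgetP => [X _ [SX _]|_]; [right|left].
Qed.

Lemma sigma_algebra_countable_gen T (D : set (set T)) :
  sigma_algebra setT [set E | exists H, [/\ countable H, H `<=` D & <<s H >> E]].
Proof.
split=> [|E [H [cH HD sHE]]|E /choice[H HP]].
- by exists set0; split=> //; exact: sigma_algebra0.
- by exists H; split=> //; exact: sigma_algebraCD.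
- exists (\bigcup_n H n); split.
  + by apply: bigcup_countable => // n _; have [] := HP n.
  + by move=> X [n _]; have [_ + _] := HP n; exact.
  + apply: sigma_algebra_bigcup => n; have [_ _] := HP n.
    by apply: sub_sigma_algebra2; exact: bigcup_sup.
Qed.

(** Each member of [G] already lies in the sigma-algebra of countably many sets of [D]. Closure of
    [H] under intersection is what the Dynkin argument later needs. *)
Lemma countable_gen T (D G : set (set T)) :
    setI_closed D -> D setT -> countable G -> G `<=` <<s D >> ->
  exists H, [/\ countable H, H `<=` D, setI_closed H & G `<=` <<s H >>].
Proof.
move=> DI DT cG GD.
have /choice[H_ HP] : forall E, exists H,
    G E -> [/\ countable H, H `<=` D & <<s H >> E].
  move=> E; have [GE|nGE] := pselect (G E); last by exists set0.
  have [|H HE] := smallest_sub (@sigma_algebra_countable_gen T D) _ (GD _ GE).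
    by move=> X DX; exists [set X]; split=> [||] //;
      [move=> _ ->|exact: sub_sigma_algebra].
  by exists H.
have cH : countable (\bigcup_(E in G) H_ E).
  by apply: bigcup_countable => // E /HP[].
have [h [Hh hH]] := countable_enum setT cH.
(* Finite intersections are indexed by lists: there are countably many, concatenation gives closure,
   and the empty list gives [setT]. *)
exists (range (fun s : seq nat => \big[setI/setT]_(k <- s) h k)); split.
- by apply: card_le_trans (card_image_le _ _) _; exact: countableP.
- move=> _ [s _ <-]; elim/big_ind: _ => // k _.
  by have [->//|[E GE HX]] := hH _ (imageT h k); have [_ + _] := HP _ GE; exact.
- by move=> _ _ [s _ <-] [t _ <-]; exists (s ++ t) => //; rewrite big_cat.
- move=> E GE; have [_ _] := HP _ GE; apply: sub_sigma_algebra2 => X HX.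
  have [|k _ <-] := Hh X; first by exists E.
  by exists [:: k] => //; rewrite big_seq1.
Qed.

Lemma measurable_countable_bigcup d (T : measurableType d) (S : set (set T)) :
  countable S -> S `<=` measurable -> measurable (\bigcup_(X in S) X).
Proof.
move=> cS mS; have [h [Sh hS]] := countable_enum set0 cS.
rewrite (_ : \bigcup_(X in S) X = \bigcup_n h n).
  by apply: bigcupT_measurable => n; have [->|/mS] := hS _ (imageT h n).
apply/seteqP; split=> [x [X /Sh[n _ <-] ?]|x [n _ hx]]; first by exists n.
by have [h0|Sn] := hS _ (imageT h n); [rewrite h0 in hx|exists (h n)].
Qed.

Lemma measurable_fun_gen d (T : measurableType d) (U : pointedType)
    (G H : set (set U)) (f : T -> U) :
  G `<=` <<s H >> -> (forall X, H X -> measurable (f @^-1` X)) ->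
  measurable_fun setT (f : T -> g_sigma_algebraType G).
Proof.
move=> GH mf; apply: (@measurability _ _ _ (g_sigma_algebraType G) setT f G) => //.
move=> _ [X GX <-]; rewrite setTI.
suff : <<s H >> `<=` [set X | measurable (f @^-1` X)] by apply; exact: GH.
apply: smallest_sub => //; split=> [|A mA|A mA] /=.
- by rewrite preimage_set0.
- by rewrite setTD preimage_setC; exact: measurableC.
- by rewrite preimage_bigcup; exact: bigcupT_measurable.
Qed.

Lemma measurable_fun_sub_gen (U : pointedType) (G H : set (set U)) d
    (V : measurableType d) (f : U -> V) :
  G `<=` <<s H >> -> measurable_fun setT (f : g_sigma_algebraType G -> V) ->
  measurable_fun setT (f : g_sigma_algebraType H -> V).
Proof.
move=> GH mf _ B mB; have := mf measurableT B mB.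
by apply: smallest_sub => //;
  exact: (@sigma_algebra_measurable _ (g_sigma_algebraType H)).
Qed.

(** * Integrals depending measurably on a parameter *)

Section SectionIntegral.
Local Open Scope ereal_scope.
Context d d' (T : measurableType d) (Y : measurableType d') (R : realType).
Variables (U : pointedType) (H : set (set U)) (HI : setI_closed H).
Variables (nu : probability T R) (s : Y -> T -> U).
Hypothesis ms : forall y X, H X -> measurable (s y @^-1` X).
Hypothesis mnu : forall X, H X -> measurable_fun setT (fun y => nu (s y @^-1` X)).

Let mS y : measurable_fun setT (s y : T -> g_sigma_algebraType H).
Proof. by apply: (measurable_fun_gen (H := H)) (ms y); exact: sub_sigma_algebra. Qed.

Let ms' y X : <<s H >> X -> measurable (s y @^-1` X).
Proof. by move=> HX; rewrite -(setTI (_ @^-1` _)); exact: mS. Qed.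

Lemma measurable_fun_section_measure X : <<s H >> X ->
  measurable_fun setT (fun y => nu (s y @^-1` X)).
Proof.
move: X; apply: (@dynkin_induction _ (g_sigma_algebraType H)) => //.
- rewrite (_ : (fun y => _) = cst 1%E)//.
  by apply/funext => y; rewrite preimage_setT probability_setT.
- move=> X mX mnuX; rewrite (_ : (fun y => _) = cst 1 \- (fun y => nu (s y @^-1` X))).
    exact: emeasurable_funB.
  by apply/funext => y /=; rewrite preimage_setC probability_setC//; exact: (ms' _ mX).
- move=> F mF tF Fn.
  rewrite (_ : (fun y => _) = (fun y => \sum_(0 <= k <oo) nu (s y @^-1` F k))).
    exact: ge0_emeasurable_sum.
  apply/funext => y; rewrite preimage_bigcup measure_semi_bigcup//.
  + by move=> k; exact: (ms' _ (mF k)).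
  + apply/trivIsetP => i j _ _ ij; rewrite -preimage_setI.
    by move/trivIsetP: tF => /(_ _ _ _ _ ij) ->//; rewrite preimage_set0.
  + by apply: bigcupT_measurable => k; exact: (ms' _ (mF k)).
Qed.

Lemma measurable_fun_section_integral (f : g_sigma_algebraType H -> \bar R) :
    (forall u, 0 <= f u) -> measurable_fun setT f ->
  measurable_fun setT (fun y => \int[nu]_t f (s y t)).
Proof.
move=> f0 mf.
(* The integral of f (s y t) is that of the fixed function f against the image of [nu] under [s y],
   and these images form a kernel in y. The measurability proof required by the pushforward is
   supplied by [mS]. *)
pose l_ y : {measure set (g_sigma_algebraType H) -> \bar R}%R :=
  pushforward nu (s y : T -> g_sigma_algebraType H).
pose l := l_ mS.
rewrite (_ : (fun y => _) = fun y => \int[l y]_u f u).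
  apply: measurable_fun_integral_kernel => // X mX.
  exact: measurable_fun_section_measure.
by apply/funext => y; rewrite /l /l_ ge0_integral_pushforward.
Qed.

End SectionIntegral.

Lemma negligible_setY_measure d (T : measurableType d) (R : realType)
    (P : {measure set T -> \bar R}%R) (A B : set T) :
    measurable A -> measurable B ->
  P.-negligible (A `\` B `|` B `\` A) -> P A = P B.
Proof.
move=> mA mB nAB.
have PI X Y : measurable X -> measurable Y ->
    P.-negligible (X `\` Y `|` Y `\` X) -> P X = P (X `&` Y).
  move=> mX mY nXY; rewrite (measureDI P mX mY) -[RHS]add0e; congr (_ + _)%E.
  apply/negligibleP; first exact: measurableD.
  by apply: negligibleS nXY; exact: subsetUl.
by rewrite (PI A B)// (PI B A) 1?setUC// setIC.
Qed.

(** * Probability measures on the definable space *)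

Section DefinableSpace.
Variables (R : realType) (L : language) (K : Type) (M : structure L).
Hypothesis hK : uncountable_inaccessible K.
Notation DS := (definable_space K M).

Lemma sub_range_solset (S : set (set M)) :
  S `<=` range (@solset L M) <-> S `<=` mdef [set: M].
Proof. by split=> h X /h /range_solsetP. Qed.

Lemma measurable_small_union (S : set (set M)) :
  small K S -> S `<=` mdef [set: M] -> measurable (\bigcup_(X in S) X : set DS).
Proof.
move=> sS /sub_range_solset Sdef; apply: sub_sigma_algebra.
by exists S.
Qed.

Lemma measurable_mdef (X : set M) : mdef [set: M] X -> measurable (X : set DS).
Proof.
move=> dX; rewrite -(bigcup_set1 (fun X => X) X).
by apply: measurable_small_union => [|_ ->//]; exact: countable_small.
Qed.

(** Definable sets form a pi-system, so P and Q agree on the sigma-algebra they generate. The small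
    unions are reached up to null sets through [probability_over]. *)
Lemma probability_over_unique (P Q : probability DS R) :
  probability_over P -> probability_over Q ->
  (forall X, mdef [set: M] X -> P X = Q X) ->
  forall B, measurable B -> P B = Q B.
Proof.
move=> overP overQ PQ.
have DM : <<s mdef [set: M] >> `<=` (measurable : set (set DS)).
  apply: smallest_sub; first exact: sigma_algebra_measurable.
  exact: measurable_mdef.
have PQD B : <<s mdef [set: M] >> B -> P B = Q B.
  apply: (@g_sigma_algebra_measure_unique _ R DS (mdef [set: M]) _
    (fun=> setT) _ _ P Q) => //.
  - exact: measurable_mdef.
  - by move=> _; exact: mdefT.
  - by rewrite -subTset => x _; exists 0%N.
  - by move=> X Y; exact: mdefI.
  - by move=> _; exact: (le_lt_trans (probability_le1 P measurableT) (ltry _)).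
(* A single [B0] has to approximate B for both measures, since P and Q are then compared on it. *)
pose approx (B : set DS) := exists2 B0, <<s mdef [set: M] >> B0 &
  P.-negligible (B `\` B0 `|` B0 `\` B) /\ Q.-negligible (B `\` B0 `|` B0 `\` B).
suff {}approxP B : measurable B -> approx B.
  move=> B mB; have [B0 sB0 [nP nQ]] := approxP _ mB; have mB0 := DM _ sB0.
  have -> : P B = P B0 := negligible_setY_measure mB mB0 nP.
  have -> : Q B = Q B0 := negligible_setY_measure mB mB0 nQ.
  exact: PQD.
apply: smallest_sub; first split.
- exists set0; first exact: sigma_algebra0.
  by rewrite setDv setU0; split; exact: negligible_set0.
- move=> A [B0 sB0 n]; exists (~` B0); first exact: sigma_algebraC.
  rewrite (_ : _ `|` _ = A `\` B0 `|` B0 `\` A)//.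
  by rewrite setTD !setDE !setCK setUC (setIC (~` B0)) (setIC (~` A)).
- move=> A /(_ _)/cid2-/all_sig2[B0 sB0 n].
  exists (\bigcup_k B0 k); first exact: sigma_algebra_bigcup.
  have sub : \bigcup_k A k `\` \bigcup_k B0 k `|` \bigcup_k B0 k `\` \bigcup_k A k
      `<=` \bigcup_k (A k `\` B0 k `|` B0 k `\` A k).
    move=> x [[[k _ ?] nx]|[[k _ ?] nx]]; exists k => //; [left|right];
      by split=> // ?; apply: nx; exists k.
  by split; apply: (negligibleS (T := DS) sub);
    apply: (negligible_bigcup (T := DS)) => k; have [] := n k.
- move=> _ [S [sS SD] <-]; have /sub_range_solset Sdef := SD.
  have [S1 [S1S cS1 PS1]] := overP _ sS SD.
  have [S2 [S2S cS2 QS2]] := overQ _ sS SD.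
  (* Joining the countable subfamilies for P and for Q gives one set that serves both. *)
  pose S0 := S1 `|` S2; pose B0 : set DS := \bigcup_(X in S0) X.
  have S0S : S0 `<=` S by move=> X [/S1S|/S2S].
  have cS0 : countable S0.
    rewrite /S0 -bigcup2E; apply: bigcup_countable => // -[|[|n]] _ //=.
  have sB0 : <<s mdef [set: M] >> B0.
    apply: (@measurable_countable_bigcup _ (g_sigma_algebraType (mdef [set: M]))) => //.
    by move=> X /S0S/Sdef dX; exact: sub_sigma_algebra.
  have BB0 : B0 `<=` \bigcup_(X in S) X by move=> x [X /S0S SX Xx]; exists X.
  have mS := measurable_small_union sS Sdef; have mB0 := DM _ sB0.
  exists B0 => //.
  rewrite (_ : B0 `\` _ = set0) ?setU0; last first.
    by rewrite -subset0 => x [/BB0].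
  (* What [B0] misses is also missed by the union of S', which already has the full measure of the
     union of S. *)
  have null (m : probability DS R) (S' : set (set M)) : S' `<=` S0 -> countable S' ->
      m (\bigcup_(X in S) X) = m (\bigcup_(X in S') X) ->
      m.-negligible ((\bigcup_(X in S) X) `\` B0).
    move=> S'S0 cS' mE; apply/negligibleP; first exact: measurableD.
    have mS' : measurable (\bigcup_(X in S') X : set DS).
      apply: measurable_countable_bigcup => // X /S'S0/S0S/Sdef.
      exact: measurable_mdef.
    apply/eqP; rewrite eq_le measure_ge0 andbT.
    rewrite -[leRHS](_ : m ((\bigcup_(X in S) X) `\` \bigcup_(X in S') X) = 0%E).
      apply: le_measure; rewrite ?inE; [exact: measurableD|exact: measurableD|].
      by move=> x [? nx]; split=> // -[X S'X Xx]; apply: nx; exists X => //; exact: S'S0.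
    have mlty : (m (\bigcup_(X in S) X) < +oo)%E.
      exact: (le_lt_trans (probability_le1 m mS) (ltry _)).
    have -> : m (\bigcup_(X in S) X `\` \bigcup_(X in S') X) =
        (m (\bigcup_(X in S) X) - m (\bigcup_(X in S) X `&` \bigcup_(X in S') X))%E.
      exact: measureD.
    rewrite setIidr; last by move=> x [X /S'S0/S0S SX Xx]; exists X.
    by rewrite mE subee// fin_num_measure.
  by split; [apply: null PS1|apply: null QS2] => //; [exact: subsetUl|exact: subsetUr].
Qed.

Hypotheses (satM : saturated M) (hcard : ([set: M] #= [set: K])%card).

(** For each n, inner regularity gives a definable subset of U whose measure is within 1/(n+1) of
    that of U, and compactness covers it by finitely many members of S. All these finite families
    together form the countable subfamily. *)
Lemma probability_over_inner (P : probability DS R) :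
  (forall U, dopen K U -> measurable (U : set DS) ->
     P U = inner_content (mdef [set: M]) P U) ->
  probability_over P.
Proof.
move=> innerP S sS SD; have /sub_range_solset Sdef := SD.
pose U := \bigcup_(X in S) X.
have mU : measurable (U : set DS) := measurable_small_union sS Sdef.
have [D sD SDD] : exists2 D : set M, small K D & S `<=` mdef D.
  exact: small_params.
have /choice[s sP] : forall n : nat, exists s : seq (set M),
    (forall Y, Y \in s -> S Y) /\
    (P U <= P (\bigcup_(Y in [set` s]) Y) + (n.+1%:R^-1)%:E)%E.
  move=> n; have n0 : (0 < n.+1%:R^-1 :> R)%R by rewrite invr_gt0.
  have Pfin : P U \is a fin_num by rewrite fin_num_measure.
  have := innerP U (dopen_bigcup hK hcard sS Sdef) mU => PE.
  rewrite PE in Pfin.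
  have [_ [X [dX XU] <-]] := ub_ereal_sup_adherent n0 Pfin.
  rewrite -/(inner_content _ _ _) -PE => /ltW PX.
  have [s [sS' Xs]] := saturated_compact satM hK hcard sD SDD dX XU.
  exists s; split=> //; rewrite -leeBlDr//; apply: le_trans PX _.
  apply: le_measure => //; rewrite inE; first exact: measurable_mdef.
  apply: measurable_countable_bigcup; first exact/finite_set_countable/finite_seq.
  by move=> Y /sS'/Sdef; exact: measurable_mdef.
have SS0 : \bigcup_n [set` s n] `<=` S by move=> X [n _ /=]; exact: (sP n).1.
have cS0 : countable (\bigcup_n [set` s n]).
  by apply: bigcup_countable => // n _; exact/finite_set_countable/finite_seq.
exists (\bigcup_n [set` s n]); split=> //.
have mU0 : measurable (\bigcup_(X in \bigcup_n [set` s n]) X : set DS).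
  by apply: measurable_countable_bigcup => // X /SS0/Sdef; exact: measurable_mdef.
apply/eqP; rewrite eq_le; apply/andP; split; last first.
  apply: le_measure; rewrite ?inE// => x [X /SS0 SX Xx]; by exists X.
apply/lee_addgt0Pr => e /ltr_add_invr[n]; rewrite add0r => ne.
apply: le_trans (sP n).2 _; apply: leeD; last by rewrite lee_fin ltW.
apply: le_measure; rewrite ?inE//.
  apply: measurable_countable_bigcup; first exact/finite_set_countable/finite_seq.
  by move=> Y /(sP n).1/Sdef; exact: measurable_mdef.
by move=> x [X sX Xx]; exists X => //; exists n.
Qed.

End DefinableSpace.

(** * Convolution *)

Section Convolution.
Variables (R : realType) (L : language) (theta : formula L 3) (K : Type).
Variable M : structure L.
Hypotheses (hK : uncountable_inaccessible K) (fM : theta_fun theta M).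
Notation DS := (definable_space K M).

(** The formula and its parameters are the same for all y, which enters as variable 1; countable
    definability can then be applied in y. *)
Lemma shift_set_formula (X : set M) : mdef [set: M] X ->
  exists k (psi : formula L k.+2) (c : 'I_k -> M),
    forall y, shift_set theta X y = [set x | sat M psi (vcons x (vcons y c))].
Proof.
move=> [k [psi [c [_ ->]]]]; exists k, (shift_formula theta psi), c => y.
by apply/seteqP; split=> x => [h|/sat_shift_formula//]; apply/sat_shift_formula.
Qed.

Lemma mdef_shift_set X y : mdef [set: M] X -> mdef [set: M] (shift_set theta X y).
Proof.
move=> /shift_set_formula[k [psi [c E]]].
by exists k.+1, psi, (vcons y c); split.
Qed.

Lemma measurable_shift_set X y :
  mdef [set: M] X -> measurable (shift_set theta X y : set DS).
Proof. by move=> dX; apply: measurable_mdef => //; exact: mdef_shift_set. Qed.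

Variables (C : pointedType) (i : C -> M) (mu nu : probability DS R).

Lemma measurable_vcons n (ys : 'I_n -> M) (G : set (set ('I_n.+1 -> M))) :
  G `<=` sigma_definable i n.+1 ->
  measurable_fun setT ((fun x => vcons x ys) : DS -> g_sigma_algebraType G).
Proof.
move=> GD; apply: measurable_fun_gen GD _ => X dX.
by apply: measurable_mdef => //; exact: mdef_vcons dX.
Qed.

Lemma measurable_vcat n k (c : 'I_k -> C) (G : set (set ('I_(n + k) -> M))) :
  G `<=` sigma_definable i (n + k) ->
  measurable_fun setT ((fun ys => vcat ys (i \o c)) :
    g_sigma_algebraType (definable i n) -> g_sigma_algebraType G).
Proof.
move=> GD; apply: measurable_fun_gen GD _ => X dX; apply: sub_sigma_algebra.
exact: definable_vcat.
Qed.

Hypotheses (hmuC : countably_definable i mu) (hnuC : countably_definable i nu).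

(** The map is the one provided by countable definability of [mu] in k + 1 variables, composed with
    the measurable map sending y to (y, c). *)
Lemma measurable_fun_shift X : mdef [set: M] X ->
  measurable_fun setT ((fun y => mu (shift_set theta X y)) : DS -> \bar R).
Proof.
move=> /shift_set_formula[k [psi [c E]]].
have [G [_ GD mG]] := hmuC k.+1.
rewrite (_ : (fun y => _) =
  (fun ys => mu [set x | sat M psi (vcons x ys)]) \o (fun y => vcons y c)).
  exact: measurableT_comp (mG psi) (measurable_vcons c GD).
by apply/funext => y; rewrite E.
Qed.

Definition conv (X : set M) : \bar R := (\int[nu]_y mu (shift_set theta X y))%E.

Lemma conv_ge0 X : (0 <= conv X)%E.
Proof. by apply: integral_ge0 => y _; exact: measure_ge0. Qed.

Lemma conv0 : conv set0 = 0%E.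
Proof.
by rewrite /conv integral0_eq// => y _; rewrite shift_set0 measure0.
Qed.

Lemma convT : conv setT = 1%E.
Proof.
rewrite /conv (_ : (fun y => mu _) = cst 1%E).
  by rewrite integral_cst// mul1e; exact: probability_setT.
by apply/funext => y; rewrite shift_setT// probability_setT.
Qed.

(** Disjoint sets have disjoint translates, so additivity holds for [mu] at every y and then for the
    integral. *)
Lemma convU X Y : mdef [set: M] X -> mdef [set: M] Y -> X `&` Y = set0 ->
  conv (X `|` Y) = (conv X + conv Y)%E.
Proof.
move=> dX dY XY; rewrite -ge0_integralD//; try exact: measurable_fun_shift.
apply: eq_integral => y _.
rewrite shift_setU measureU//; try exact: measurable_shift_set.
by rewrite -shift_setI// XY shift_set0.
Qed.

Lemma exists_conv : saturated M -> ([set: M] #= [set: K])%card ->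
  exists xi : probability DS R,
    probability_over xi /\ forall X, mdef [set: M] X -> xi X = conv X.
Proof.
move=> satM hcard.
have [m [mO mD mE]] : exists m : outer_measure R M,
  [/\ forall U, dopen K U -> m.-caratheodory U,
      forall X, mdef [set: M] X -> m X = conv X &
      forall U, dopen K U -> m U = inner_content (mdef [set: M]) conv U].
  apply: exists_outer_measure.
  - exact: mdefT.
  - by move=> X Y; exact: mdefI.
  - by move=> X; exact: mdefC.
  - exact: mdef_dopen.
  - by move=> U V; exact: dopenI.
  - by move=> U; exact: dopen_bigcupT.
  - by move=> U X; exact: dopen_cover.
  - exact: conv0.
  - by move=> X _; exact: conv_ge0.
  - by rewrite convT ltry.
  - exact: convU.
have [||xi xiE] := @exists_probability_caratheodory R M m (small_unions K).
- by rewrite mD ?convT//; exact: mdefT.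
- move=> _ [S [sS /sub_range_solset SD] <-]; apply: mO.
  exact: dopen_bigcup.
have xiD X : mdef [set: M] X -> xi X = conv X.
  by move=> dX; rewrite xiE ?mD//; exact: measurable_mdef.
exists xi; split=> //.
apply: probability_over_inner => // U oU mU.
(* Since [xi] and [conv] agree on definable sets, they have the same inner content. *)
rewrite xiE// mE//; congr ereal_sup.
by apply/seteqP; split=> _ [X [dX XU] <-]; exists X => //; rewrite xiD.
Qed.

(** Countable definability of [nu] concerns formulas without constants. The constants of X therefore
    become k further variables, and the countable family for n + k variables is pulled back along ys
    |-> (ys, c). *)
Lemma section_gen n (X : set ('I_n.+1 -> M)) : definable i n.+1 X ->
  exists G, [/\ countable G, G `<=` sigma_definable i n &
    measurable_fun setT ((fun ys => nu [set z | X (vcons z ys)]) :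
      g_sigma_algebraType G -> \bar R)].
Proof.
move=> /definableP[k [psi [c XE]]].
have [G' [cG' GD' mG']] := hnuC (n + k).
pose s ys := vcat ys (i \o c) : 'I_(n + k) -> M.
exists [set s @^-1` Y | Y in G']; split.
- by apply: card_le_trans (card_image_le _ _) cG'.
- move=> _ [Y GY <-]; rewrite -(setTI (_ @^-1` _)).
  apply: (measurable_vcat c GD') => //; exact: sub_sigma_algebra.
- rewrite (_ : (fun ys => _) =
    (fun v => nu [set z | sat M psi (vcons z v)]) \o s).
    apply: (measurableT_comp (mG' psi)).
    apply: (measurable_fun_gen (H := G')); first exact: sub_sigma_algebra.
    by move=> Y GY; apply: sub_sigma_algebra; exists Y.
  apply/funext => ys /=; congr (nu _); apply/seteqP.
  by split=> z; rewrite XE /= vcat_vcons.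
Qed.

(** [H] and the families [G X] are chosen before [phi], so one countable family serves all
    formulas. *)
Lemma countably_definable_conv (xi : probability DS R) :
  (forall X, mdef [set: M] X -> xi X = conv X) -> countably_definable i xi.
Proof.
move=> xiE n; have [G1 [cG1 G1D mG1]] := hmuC n.+1.
have [H [cH HD HI G1H]] := countable_gen (@definableI _ _ _ i n.+1)
  (definableT i n.+1) cG1 G1D.
have /choice[G GP] : forall X, exists G, H X ->
    [/\ countable G, G `<=` sigma_definable i n &
    measurable_fun setT ((fun ys => nu [set z | X (vcons z ys)]) :
      g_sigma_algebraType G -> \bar R)].
  move=> X; have [/HD/section_gen[G ?]|nHX] := pselect (H X); first by exists G.
  by exists set0.
exists (\bigcup_(X in H) G X); split.
- by apply: bigcup_countable => // X /GP[].
- by move=> Y [X /GP[_ + _]]; exact.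
move=> phi.
(* At v = (z, ys) this is the integrand: the [mu]-measure of the x such that phi(x + z, ys). It is
   measurable for the sigma-algebra generated by [H]. *)
pose f v := mu [set x | sat M (shift_formula theta phi) (vcons x v)].
rewrite (_ : (fun ys => xi _) = fun ys => (\int[nu]_z f (vcons z ys))%E).
  apply: (@measurable_fun_section_integral _ _ DS
    (g_sigma_algebraType (\bigcup_(X in H) G X)) R _ H HI nu
    (fun ys z => vcons z ys) _ _ f).
  - by move=> ys X /HD dX; apply: measurable_mdef => //; exact: mdef_vcons dX.
  - move=> X HX; have [_ _] := GP _ HX.
    apply: measurable_fun_sub_gen => Y GY; apply: sub_sigma_algebra.
    by exists X.
  - by move=> v; exact: measure_ge0.
  - exact: (measurable_fun_sub_gen G1H (mG1 _)).
apply/funext => ys; rewrite xiE; last by exists n, phi, ys.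
apply: eq_integral => z _; congr (mu _).
by apply/seteqP; split=> x => [h|/sat_shift_formula//]; apply/sat_shift_formula.
Qed.

End Convolution.

Theorem theorem3p10 (R : realType) (L : language) (A : structure L)
    (hLA : countable [set: symbols L] \/
           ~ has_independence_property (theory A))
    (theta : formula L 3) (htheta : comm_monoid_axioms theta A)
    (K : Type) (hK : uncountable_inaccessible K)
    (hKLA : small K [set: (symbols L + A)%type])
    (sA : structure L) (j : A -> sA) (hj : elementary_embedding j)
    (hsat : saturated sA) (hcard : ([set: sA] #= [set: K])%card)
    (C : structure L) (i : C -> sA) (hi : elementary_embedding i)
    (hC : small K [set: C])
    (mu nu : probability (definable_space K sA) R)
    (hmu : probability_over mu) (hnu : probability_over nu)
    (hmuC : countably_definable i mu) (hnuC : countably_definable i nu) :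
  [/\ (* the integrals make sense *)
      forall phi : formula (add_constants L sA) 1,
        (forall y : sA,
           measurable (translate theta phi y : set (definable_space K sA))) /\
        measurable_fun [set: definable_space K sA]
          ((fun y => mu (translate theta phi y)) : definable_space K sA -> \bar R),
      (* their value depends only on the set defined by phi *)
      forall phi psi : formula (add_constants L sA) 1, solset phi = solset psi ->
        convolution theta mu nu phi = convolution theta mu nu psi &
      exists xi : probability (definable_space K sA) R,
        [/\ probability_over xi,
            forall phi : formula (add_constants L sA) 1,
              xi (solset phi) = convolution theta mu nu phi,
            countably_definable i xi &
            forall xi' : probability (definable_space K sA) R,
              probability_over xi' ->
              (forall phi : formula (add_constants L sA) 1,
                 xi' (solset phi) = convolution theta mu nu phi) ->
              forall B : set (definable_space K sA),
                measurable B -> xi' B = xi B]].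
Proof.
(* Unique existence of sums holds in [A] and is first-order, so it passes to [sA] along [j]. *)
have fsA : theta_fun theta sA.
  apply: theta_fun_elementary hj _ => x y.
  have [/(_ x y)[z [xyz uz]] _ _ _] := htheta.
  by exists z => // z' /uz.
have dsol (phi : formula (add_constants L sA) 1) : mdef [set: sA] (solset phi).
  by apply/range_solsetP; exists phi.
split.
- move=> phi; split=> [y|]; first exact: (measurable_shift_set theta hK y (dsol phi)).
  exact: (measurable_fun_shift theta hK hmuC (dsol phi)).
- by move=> phi psi E; rewrite /convolution /translate E.
have [xi [overxi xiE]] := exists_conv hK fsA nu hmuC hsat hcard.
exists xi; split=> // [phi||xi' overxi' xi'E].
- exact: xiE.
- exact: (countably_definable_conv hK hmuC hnuC xiE).
- apply: probability_over_unique => // X /range_solsetP[phi _ <-].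
  by rewrite xi'E xiE.
Qed.
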